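(* Let $n\ge 2$, $k \in \{1,\dots,n-1\}$, let $K \in \mathcal{K}^n$ be symmetric with $\mathcal{E}_J(K) = \mathbb{B}^n$, and let $E \subset K$ be a $k$-ellipsoid. Then $$\mathrm{vol}_k(E) \le \mathrm{vol}_k\left(\sqrt{\tfrac{n}{k}}\,\mathbb{B}^k\right).$$ Equality holds if $K$ is a regular cross-polytope or a cube (with $\mathcal{E}_J(K) = \mathbb{B}^n$) and $E$ is chosen appropriately; that is, for each such $K$ there exists a $k$-ellipsoid $E \subset K$ attaining equality.
   Context: $\mathcal{K}^n$ is the family of convex bodies in $\mathbb{R}^n$, i.e., compact convex sets with non-empty interior. $K$ is (centrally) symmetric if $K - c = c - K$ for some $c \in \mathbb{R}^n$. $\mathbb{B}^n$ is the closed Euclidean unit ball in $\mathbb{R}^n$, and $\mathrm{vol}_k$ is $k$-dimensional volume. A $k$-ellipsoid is the image of $\mathbb{B}^k$ under an injective affine map $\mathbb{R}^k \to \mathbb{R}^n$. The John ellipsoid $\mathcal{E}_J(K)$ of $K \in \mathcal{K}^n$ is the (unique) volume-maximal $n$-ellipsoid contained in $K$. *)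

(* Defs.v *)
From mathcomp Require Import all_boot all_order all_algebra.
From mathcomp Require Import all_classical all_reals all_analysis.
Set Implicit Arguments.
Unset Strict Implicit.
Unset Printing Implicit Defensive.
Import Order.TTheory GRing.Theory Num.Theory.
Import numFieldNormedType.Exports.
Local Open Scope classical_set_scope.
Local Open Scope ring_scope.

(* The library norm on ['rV[R]_n] is the sup norm, hence this one. *)
Definition euclidean_norm (R : realType) (n : nat) (x : 'rV[R]_n) : R :=
  Num.sqrt (\sum_(i < n) x 0 i ^+ 2).

Definition unit_ball (R : realType) (n : nat) : set 'rV[R]_n :=
  [set x | euclidean_norm x <= 1].

Definition box (R : realType) (n : nat) (a b : 'rV[R]_n) : set 'rV[R]_n :=
  [set x | forall i, a 0 i <= x 0 i <= b 0 i].

Definition box_cover (R : realType) (n : nat) (A : set 'rV[R]_n)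
    (a b : nat -> 'rV[R]_n) : Prop :=
  (forall j i, a j 0 i <= b j 0 i) /\ A `<=` \bigcup_j box (a j) (b j).

(* n-dimensional volume on R^n, i.e. Lebesgue outer measure, which is Lebesgue
   measure on the (compact) sets it is used for. Meant for n > 0: for n = 0 all
   boxes have volume 1 and all covers are infinite. *)
Definition vol (R : realType) (n : nat) (A : set 'rV[R]_n) : \bar R :=
  ereal_inf [set v | exists a b, box_cover A a b /\
    v = (\sum_(0 <= j <oo) (\prod_(i < n) (b j 0 i - a j 0 i))%:E)%E].

Definition affine_map (R : realType) (k n : nat) (A : 'M[R]_(k, n))
    (c : 'rV[R]_n) (x : 'rV[R]_k) : 'rV[R]_n := x *m A + c.

(* A has orthonormal rows iff x |-> x *m A + c is a Euclidean isometry. *)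
Definition orthonormal_rows (R : realType) (k n : nat) (A : 'M[R]_(k, n)) : Prop :=
  A *m A^T = 1%:M.

(* k-dimensional volume of a subset S of a k-dimensional flat of R^n: the
   volume in R^k of S read in an isometric chart of a k-flat containing S. All
   such charts give the same value, which the infimum merely selects; it is
   +oo when S lies in no k-flat. *)
Definition flat_vol (R : realType) (k n : nat) (S : set 'rV[R]_n) : \bar R :=
  ereal_inf [set v | exists (A : 'M[R]_(k, n)) (c : 'rV[R]_n),
    [/\ orthonormal_rows A, S `<=` range (affine_map A c) &
        v = vol (affine_map A c @^-1` S)]].

Definition convex_body (R : realType) (n : nat) (K : set 'rV[R]_n) : Prop :=
  [/\ compact K, convex_set (K : set (convex_lmodType 'rV[R]_n)) &
      K° !=set0].

Definition centrally_symmetric (R : realType) (n : nat) (K : set 'rV[R]_n) : Prop :=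
  exists c : 'rV[R]_n, [set x - c | x in K] = [set c - x | x in K].

Definition ellipsoid (R : realType) (k n : nat) (E : set 'rV[R]_n) : Prop :=
  exists (A : 'M[R]_(k, n)) (c : 'rV[R]_n),
    injective (affine_map A c) /\ E = affine_map A c @` @unit_ball R k.

(* The uniqueness of the maximizer is a theorem, not part of the definition. *)
Definition john_ellipsoid (R : realType) (n : nat) (K E : set 'rV[R]_n) : Prop :=
  [/\ ellipsoid n E, E `<=` K &
      forall E', ellipsoid n E' -> E' `<=` K -> (vol E' <= vol E)%E].

Definition similar (R : realType) (n : nat) (S T : set 'rV[R]_n) : Prop :=
  exists (r : R) (U : 'M[R]_n) (c : 'rV[R]_n),
    [/\ 0 < r, orthonormal_rows U & T = affine_map (r *: U) c @` S].

Definition cube (R : realType) (n : nat) (K : set 'rV[R]_n) : Prop :=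
  similar [set x | forall i, `|x 0 i| <= 1] K.

Definition regular_cross_polytope (R : realType) (n : nat)
    (K : set 'rV[R]_n) : Prop :=
  similar [set x | \sum_(i < n) `|x 0 i| <= 1] K.

(* Main.v *)
Require Import Defs.
From mathcomp Require Import all_boot all_order all_algebra.
From mathcomp Require Import all_classical all_reals all_analysis.
From mathcomp Require Import measurable_realfun.
From mathcomp Require Import ring lra.
Set Implicit Arguments.
Unset Strict Implicit.
Unset Printing Implicit Defensive.
Import Order.TTheory GRing.Theory Num.Theory.
Import numFieldNormedType.Exports.
Local Open Scope classical_set_scope.
Local Open Scope ring_scope.

(** The inequality.  Translate the centre of symmetry of K to the origin.  The
    translated body L still contains the unit ball B, because x is the midpoint
    of x + p and x - p, and for the same reason it contains the translate
    { t A : |t| <= 1 } of E that is centred at the origin.  The n-ellipsoids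
    in L are translates of those in K, so none has a larger volume than B.

    For a^2 + b^2 = 1 and |x|^2 + |t|^2 <= 1, Cauchy-Schwarz makes
    a x + b t A a sub-convex combination of a point of B and a point of the
    centred E, so it lies in L ([convex_l2_combination]).  An orthogonal change
    of coordinates turns A into (T 0) with T lower triangular
    ([lq_decomposition]).  The set of all a x + b t A then contains an
    n-ellipsoid with a lower triangular matrix whose diagonal consists of the
    k numbers sqrt (a^2 + b^2 T_ii^2) and n - k copies of a.  Its volume is at
    most that of B; with s = b^2 / a^2 this reads
      prod_i (1 + s T_ii^2) <= (1 + s)^n    for every s > 0,
    and s -> 0 gives sum_i T_ii^2 <= n ([john_sum_sqr_le]).  By the inequality
    of the arithmetic and geometric means |det T| <= (n / k)^(k / 2)
    ([john_det_le]), while vol_k E = |det T| vol_k (B^k).  This variation of the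
    John ellipsoid stands in for the decomposition of the identity over contact
    points.

    Volume.  The argument above needs two facts on the outer measure [vol]: the
    change of variables formula [vol_affine_map], and 0 < vol B < +oo, without
    which maximality would say nothing about determinants.  The formula is
    checked on boxes for diagonal matrices and for shears, which generate all
    invertible matrices by Gaussian elimination.  Positivity comes from the fact
    that a cube of side 1 has no box cover of total volume below 1, shown by
    integrating over parallel slices ([cube_cover_ge1]).

    Equality.  A cube (cross-polytope) around B is, up to a rotation, r S + c
    with S the standard cube (cross-polytope) and r >= 1 (r >= sqrt n).  So it is
    enough to place a k-ball of radius sqrt (n / k) in S (in sqrt n S).  For
    the cross-polytope a coordinate k-plane serves.  For the cube one needs an
    orthonormal k-frame in R^n whose n columns all have squared length k / n;
    it exists by [equal_norm_frame]. *)

(** * Volume as an outer measure *)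

Lemma box_vol_ge0 (R : realType) (n : nat) (a b : 'rV[R]_n) :
  (forall i, a 0 i <= b 0 i) -> 0 <= \prod_(i < n) (b 0 i - a 0 i).
Proof. by move=> ab; apply: prodr_ge0 => i _; rewrite subr_ge0. Qed.

Lemma vol_ge0 (R : realType) (n : nat) (A : set 'rV[R]_n) : (0 <= vol A)%E.
Proof.
apply: le_ereal_inf_tmp => _ [a [b [[ab _] ->]]].
by apply: nneseries_ge0 => j _ _; rewrite lee_fin box_vol_ge0.
Qed.

Lemma le_vol (R : realType) (n : nat) (A B : set 'rV[R]_n) :
  A `<=` B -> (vol A <= vol B)%E.
Proof.
move=> AB; apply/ereal_inf_le_tmp => x [a [b [[ab Bab] ->]]].
by exists a, b; split => //; split => //; exact: subset_trans Bab.
Qed.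

(** Cover the j-th set up to an error e / 2^(j+1), and enumerate all the boxes
    so obtained along a bijection between nat and nat * nat. *)
Lemma vol_sigma_subadditive (R : realType) (n : nat) (A : nat -> set 'rV[R]_n) :
  (vol (\bigcup_j A j) <= \sum_(0 <= j <oo) vol (A j))%E.
Proof.
have [[i ioo]|] := pselect (exists i, vol (A i) = +oo%E).
  rewrite (eseries_pinfty _ _ ioo) ?leey// => m _.
  by rewrite -ltNye (lt_le_trans _ (vol_ge0 _)).
rewrite -forallNE => Aoo.
suff add2e (e : {posnum R}) :
    (vol (\bigcup_n A n) <= \sum_(0 <= i <oo) vol (A i) + e%:num%:E)%E.
  by apply/lee_addgt0Pr => _/posnumP[].
rewrite (le_trans _ (epsilon_trick _ _ _))//; last by move=> m; exact: vol_ge0.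
pose boxvol (ab : 'rV[R]_n * 'rV[R]_n) : \bar R :=
  (\prod_(i < n) (ab.2 0 i - ab.1 0 i))%:E.
pose P m (c : nat -> 'rV[R]_n * 'rV[R]_n) :=
  box_cover (A m) (fun j => (c j).1) (fun j => (c j).2) /\
  (\sum_(0 <= k <oo) boxvol (c k) <= vol (A m) + (e%:num / (2 ^ m.+1)%:R)%:E)%E.
have [G PG] : {G : nat -> nat -> 'rV[R]_n * 'rV[R]_n & forall m, P m (G m)}.
  apply: (@choice _ _ P) => m; rewrite /P.
  have volfin : vol (A m) \is a fin_num.
    by rewrite ge0_fin_numE ?vol_ge0// ltey; apply/eqP/Aoo.
  have em : (0 < e%:num / (2 ^ m.+1)%:R :> R)%R by [].
  have [_ [a [b [abA ->]]] /ltW le_v] := lb_ereal_inf_adherent em volfin.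
  by exists (fun j => (a j, b j)).
have G_ge0 x : (0 <= (boxvol \o uncurry G) x)%E.
  rewrite /= lee_fin; apply: box_vol_ge0 => i; case: x => j k /=.
  exact: (PG j).1.1.
apply: (@le_trans _ _ (\esum_(i in setT) (boxvol \o uncurry G) i)%E).
  apply: ereal_inf_lbound => /=.
  have /card_esym/ppcard_eqP[f] := card_nat2.
  exists (fun j => (uncurry G (f j)).1), (fun j => (uncurry G (f j)).2).
  split.
    split => [j i|x [j _ /((PG j).1.2)[k _ Gx]]].
      by case: (f j) => u v; exact: (PG u).1.1.
    by exists (f^-1%FUN (j, k)) => //=; rewrite invK ?inE.
  transitivity (\sum_(0 <= j <oo) (boxvol \o uncurry G) (f j))%E; last first.
    by apply: eq_eseriesr => j _; rewrite /= /boxvol.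
  rewrite nneseries_esumT; last by move=> j; exact: G_ge0.
  rewrite -(esum_image setT f (boxvol \o uncurry G))//.
  by rewrite image_eq.
rewrite (_ : esum _ _ = (\sum_(0 <= i <oo) \sum_(0 <= j <oo) boxvol (G i j))%E).
  apply: lee_nneseries => m *; last exact: (PG m).2.
  by apply: nneseries_ge0 => k *; exact: (G_ge0 (m, k)).
pose J : nat -> set (nat * nat) := fun i => [set (i, j) | j in setT].
rewrite (_ : setT = \bigcup_k J k); last first.
  by rewrite predeqE => -[u v]; split => // _; exists u => //; exists v.
rewrite esum_bigcupT /=; last 2 first.
- apply/trivIsetP => i j _ _ ij.
  rewrite predeqE => -[u v] /=; split => //= -[] [_] _ [<-{u} _].
  by move=> [m' _] [] /esym/eqP; rewrite (negbTE ij).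
- by move=> x; exact: G_ge0.
rewrite nneseries_esumT//; last first.
  by move=> m; apply: nneseries_ge0 => k _ _; exact: (G_ge0 (m, k)).
apply: eq_esum => j _.
rewrite nneseries_esumT; last by move=> k; exact: (G_ge0 (j, k)).
by rewrite /J esum_image//; move=> u v _ _ [].
Qed.

(** The cover is completed by degenerate boxes, whose volume vanishes because
    n > 0. *)
Lemma vol_box_le (R : realType) (n : nat) (a b : 'rV[R]_n) :
  (0 < n)%N -> (forall i, a 0 i <= b 0 i) ->
  (vol (box a b) <= (\prod_(i < n) (b 0 i - a 0 i))%:E)%E.
Proof.
move=> n0 ab; apply: ereal_inf_lbound.
exists (fun=> a), (fun j => if j is 0 then b else a); split.
  split => [[|j] i //|x xab]; first by exists 0%N.
rewrite nneseries_recl//; last first.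
  by case=> [|j] _; rewrite lee_fin; apply: box_vol_ge0.
rewrite eseries0 ?adde0// => -[|j] // _ _.
by rewrite (bigD1 (Ordinal n0))//= subrr mul0r.
Qed.

Lemma vol_set0 (R : realType) (n : nat) : (0 < n)%N ->
  vol (set0 : set 'rV[R]_n) = 0%E.
Proof.
move=> n0; apply/eqP; rewrite eq_le vol_ge0 andbT.
apply: (@le_trans _ _ (vol (box (0 : 'rV[R]_n) 0))); first exact: le_vol.
apply: le_trans (vol_box_le n0 _) _ => //.
by rewrite (bigD1 (Ordinal n0))//= subrr mul0r.
Qed.

Lemma vol_fin_subadditive (R : realType) (n N : nat) (A : nat -> set 'rV[R]_n)
    (S : set 'rV[R]_n) : (0 < n)%N ->
  (forall x, S x -> exists2 l, (l < N)%N & A l x) ->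
  (vol S <= \sum_(l < N) vol (A l))%E.
Proof.
move=> n0 SA; pose B l := if (l < N)%N then A l else set0.
apply: (@le_trans _ _ (vol (\bigcup_l B l))).
  by apply: le_vol => x /SA[l lN Alx]; exists l; rewrite // /B lN.
apply: le_trans (vol_sigma_subadditive B) _.
rewrite (nneseries_split 0 N); last by move=> *; exact: vol_ge0.
rewrite eseries0 ?adde0; last first.
  by move=> l; rewrite /= add0n /B leqNgt => /negbTE -> _; exact: vol_set0.
rewrite add0n big_mkord.
by apply: lee_sum => l _; rewrite /B ltn_ord.
Qed.

(** A map can be tested on boxes alone: the image of a cover by boxes is a
    cover by images of boxes, and volume is countably subadditive. *)
Lemma vol_image_le (R : realType) (n : nat) (f : 'rV[R]_n -> 'rV[R]_n) (c : R)
    (S : set 'rV[R]_n) : 0 < c ->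
  (forall a b : 'rV[R]_n, (forall i, a 0 i <= b 0 i) ->
     (vol (f @` box a b) <= (c * \prod_(i < n) (b 0 i - a 0 i))%:E)%E) ->
  (vol (f @` S) <= c%:E * vol S)%E.
Proof.
move=> c0 fbox; rewrite -lee_pdivrMl//; apply: le_ereal_inf_tmp.
move=> _ [a [b [[ab Sab] ->]]]; rewrite lee_pdivrMl//.
apply: (@le_trans _ _ (vol (\bigcup_j (f @` box (a j) (b j))))).
  by apply: le_vol => _ [x /Sab[j _ jx] <-]; exists j => //; exists x.
apply: le_trans (vol_sigma_subadditive _) _.
rewrite -nneseriesZl; last by move=> *; rewrite lee_fin box_vol_ge0.
by apply: lee_nneseries => j *; rewrite ?vol_ge0// -EFinM; exact: fbox.
Qed.

Lemma vol_translate (R : realType) (n : nat) (c : 'rV[R]_n) (S : set 'rV[R]_n) :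
  (0 < n)%N -> vol [set x + c | x in S] = vol S.
Proof.
move=> n0.
have le_shift (d : 'rV[R]_n) (A : set 'rV[R]_n) :
    (vol [set (x + d)%R | x in A] <= vol A)%E.
  rewrite -[leRHS]mul1e; apply: vol_image_le => // a b ab; rewrite mul1r.
  apply: (@le_trans _ _ (vol (box (a + d)%R (b + d)%R))).
    by apply: le_vol => _ [x xab <-] i; rewrite !mxE !lerD2r.
  apply: le_trans (vol_box_le n0 _) _; first by move=> i; rewrite !mxE lerD2r.
  rewrite lee_fin le_eqVlt; apply/orP; left; apply/eqP.
  by apply: eq_bigr => i _; rewrite !mxE opprD addrACA subrr addr0.
apply/eqP; rewrite eq_le le_shift/=.
apply: le_trans (le_shift (- c) _); apply: le_vol => x Sx.
by exists (x + c); [exists x|rewrite addrK].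
Qed.

(** * Volume of diagonal and sheared images *)

Lemma vol_diag_le (R : realType) (n : nat) (d : 'rV[R]_n) (S : set 'rV[R]_n) :
  (0 < n)%N -> (forall i, d 0 i != 0) ->
  (vol [set (x *m diag_mx d)%R | x in S] <= `|\det (diag_mx d)|%:E * vol S)%E.
Proof.
move=> n0 d_neq0; rewrite det_diag; apply: vol_image_le => [|a b ab].
  by rewrite normr_gt0; apply/prodf_neq0 => i _.
pose lo : 'rV[R]_n := \row_i Num.min (a 0 i * d 0 i) (b 0 i * d 0 i).
pose hi : 'rV[R]_n := \row_i Num.max (a 0 i * d 0 i) (b 0 i * d 0 i).
apply: (@le_trans _ _ (vol (box lo hi))).
  apply: le_vol => _ [x xab <-] i; have /andP[ax xb] := xab i.
  rewrite mul_mx_diag !mxE ge_min le_max.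
  have [d0|/ltW d0] := leP 0 (d 0 i).
    by rewrite (ler_wpM2r d0 ax) (ler_wpM2r d0 xb) orbT.
  by rewrite (ler_wnM2r d0 ax) (ler_wnM2r d0 xb) orbT.
apply: le_trans (vol_box_le n0 _) _.
  by move=> i; rewrite !mxE ge_min !le_max !lexx.
rewrite lee_fin normr_prod -big_split le_eqVlt /=; apply/orP; left; apply/eqP.
apply: eq_bigr => i _; rewrite !mxE maxr_absE minr_absE.
have ba : 0 <= b 0 i - a 0 i by rewrite subr_ge0.
rewrite -[in RHS](ger0_norm ba) -normrM mulrBr ![_ * d 0 i]mulrC.
by rewrite [in RHS]distrC; lra.
Qed.

(** Cut the box into N + 1 slabs across coordinate i.  On one slab the shear
    moves coordinate j by a constant, up to an error of order 1 / N, so the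
    image of the slab fits in a box that is only slightly too wide. *)
Lemma vol_shear_box_le (R : realType) (n : nat) (i j : 'I_n) (c : R)
    (a b : 'rV[R]_n) : i != j -> (forall l, a 0 l <= b 0 l) ->
  (vol [set (x *m (1%:M + c *: delta_mx i j))%R | x in box a b]
   <= (\prod_(l < n) (b 0 l - a 0 l))%:E)%E.
Proof.
move=> ij ab; have n0 : (0 < n)%N by apply: leq_trans (ltn_ord i).
have shearE (x : 'rV[R]_n) l : (x *m (1%:M + c *: delta_mx i j)) 0 l =
    x 0 l + (if l == j then c * x 0 i else 0).
  rewrite mulmxDr mulmx1 -scalemxAr !mxE; congr (_ + _).
  rewrite (bigD1 i)//= big1 => [|m mi]; last by rewrite !mxE (negbTE mi) mulr0.
  by rewrite addr0 !mxE eqxx/=; case: eqP => _; rewrite (mulr1, mulr0) ?mulr0.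
set P := \prod_(l < n | (l != i) && (l != j)) (b 0 l - a 0 l).
have P0 : 0 <= P by apply: prodr_ge0 => l _; rewrite subr_ge0.
have prodE (f : 'I_n -> R) : \prod_(l < n) f l =
    f i * (f j * \prod_(l < n | (l != i) && (l != j)) f l).
  by rewrite (bigD1 i)//= (bigD1 j)//= eq_sym.
set w := b 0 i - a 0 i; have w0 : 0 <= w by rewrite subr_ge0.
suff bound (N : nat) :
   (vol [set (x *m (1%:M + c *: delta_mx i j))%R | x in box a b] <=
      (\prod_(l < n) (b 0 l - a 0 l))%:E +
      (w * (2 * `|c| * w * P) / N.+1%:R)%:E)%E.
  apply/lee_addgt0Pr => e e0; set C := w * _ in bound.
  have C0 : 0 <= C by rewrite !mulr_ge0.
  apply: le_trans (bound (Num.bound (C / e))) _; apply: leeD => //.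
  rewrite lee_fin ler_pdivrMr// mulrC -ler_pdivrMr//; apply: ltW.
  apply: lt_trans (archi_boundP _) _; first by rewrite divr_ge0// ltW.
  by rewrite ltr_nat.
set h := w / N.+1%:R; have h0 : 0 <= h by rewrite divr_ge0.
have hN : h * N.+1%:R = w by rewrite /h divfK// pnatr_eq0.
pose m l := a 0 i + l%:R * h.
pose lo (l : nat) : 'rV[R]_n := \row_u (if u == i then m l else
  if u == j then a 0 j + c * m l - `|c| * h else a 0 u).
pose hi (l : nat) : 'rV[R]_n := \row_u (if u == i then m l + h else
  if u == j then b 0 j + c * m l + `|c| * h else b 0 u).
have lohi l u : lo l 0 u <= hi l 0 u.
  rewrite !mxE; case: eqP => _; first by rewrite lerDl.
  case: eqP => _ //; have ch : 0 <= `|c| * h by rewrite mulr_ge0.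
  by have := ab j; lra.
apply: le_trans
  (@vol_fin_subadditive _ _ N.+1 (fun l => box (lo l) (hi l)) _ n0 _) _.
  move=> _ [x xab <-].
  have [l lN /andP[ml mh]] : exists2 l, (l < N.+1)%N & m l <= x 0 i <= m l + h.
    have /andP[ai] := xab i; have -> : b 0 i = a 0 i + N.+1%:R * h.
      by rewrite mulrC hN /w; lra.
    elim: (N) => [|M IHM] xM.
      by exists 0%N => //; rewrite /m mul0r addr0 ai; lra.
    have [/IHM[l lM ?]|Mx] := leP (x 0 i) (a 0 i + M.+1%:R * h).
      by exists l => //; exact: ltnW.
    exists M.+1 => //; rewrite /m (ltW Mx); move: xM.
    by rewrite -[M.+2%:R]natr1; lra.
  exists l => // u; rewrite shearE !mxE; have /andP[au ub] := xab u.
  have [ui|ui] := eqVneq u i; first by rewrite ui (negbTE ij) addr0 ml mh.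
  have [uj|uj] := eqVneq u j; last by rewrite addr0 au ub.
  have : `|c * (x 0 i - m l)| <= `|c| * h.
    rewrite normrM; apply: ler_wpM2l => //; rewrite ger0_norm ?subr_ge0//.
    by rewrite lerBlDl.
  rewrite ler_norml mulrBr => /andP[]; rewrite -uj; lra.
apply: (@le_trans _ _
  (\sum_(l < N.+1) (h * ((b 0 j - a 0 j + 2 * `|c| * h) * P))%:E)%E).
  apply: lee_sum => l _; apply: le_trans (vol_box_le n0 (lohi l)) _.
  rewrite lee_fin prodE le_eqVlt; apply/orP; left; apply/eqP.
  rewrite !mxE !eqxx eq_sym (negbTE ij) -addrA addrA addrAC subrr add0r.
  congr (_ * (_ * _)); first by lra.
  by apply: eq_bigr => u /andP[/negbTE ui /negbTE uj]; rewrite !mxE ui uj.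
rewrite -EFinD sumEFin lee_fin sumr_const card_ord -[leLHS]mulr_natl.
rewrite prodE le_eqVlt; apply/orP; left; apply/eqP.
rewrite -/P -/w -hN; have : N.+1%:R != 0 :> R by rewrite pnatr_eq0.
by set t := N.+1%:R; move=> t0; field.
Qed.

(** * The change of variables formula *)

Inductive elementary_product (F : fieldType) (n : nat) : 'M[F]_n -> Prop :=
| elementary_diag (d : 'rV[F]_n) : (forall i, d 0 i != 0) ->
     elementary_product (diag_mx d)
| elementary_shear (i j : 'I_n) (c : F) : i != j ->
    elementary_product (1%:M + c *: delta_mx i j)
| elementary_mul M N : elementary_product M -> elementary_product N ->
    elementary_product (M *m N).

Lemma elementary_product1 (F : fieldType) (n : nat) :
  elementary_product (1%:M : 'M[F]_n).
Proof.
by rewrite -diag_const_mx; apply: elementary_diag => i; rewrite mxE oner_neq0.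
Qed.

Lemma elementary_product_tr (F : fieldType) (n : nat) (M : 'M[F]_n) :
  elementary_product M -> elementary_product M^T.
Proof.
elim=> [d d0|i j c ij|A B _ IHA _ IHB].
- by rewrite tr_diag_mx; exact: elementary_diag.
- rewrite linearD linearZ /= trmx1 trmx_delta; apply: elementary_shear.
  by rewrite eq_sym.
- by rewrite trmx_mul; exact: elementary_mul.
Qed.

(** This and the next lemma give the block matrices into which one step of
    elimination factors a matrix. *)
Lemma elementary_product_dr (F : fieldType) (n : nat) (M : 'M[F]_n) :
  elementary_product M ->
  elementary_product (block_mx 1%:M 0 0 M : 'M[F]_(1 + n)).
Proof.
elim=> [d d0|i j c ij|A B _ IHA _ IHB].
- rewrite (_ : block_mx _ _ _ _ = diag_mx (row_mx 1%:M d)).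
    apply: elementary_diag => i; rewrite mxE.
    by case: splitP => l _; rewrite ?mxE ?d0// [l]ord1 eqxx oner_neq0.
  rewrite diag_mx_row; congr block_mx.
  by apply/matrixP => i j; rewrite !mxE [i]ord1 [j]ord1.
- have := @elementary_shear F (1 + n) (rshift 1 i) (rshift 1 j) c.
  rewrite (inj_eq (@rshift_inj _ _)) => /(_ ij).
  rewrite delta_mx_dshift delta_mx_rshift scalar_mx_block.
  rewrite -[X in col_mx X _]row_mx0 -/(block_mx 0 0 0 _).
  by rewrite scale_block_mx add_block_mx !scaler0 !addr0.
- have := elementary_mul IHA IHB.
  by rewrite mulmx_block !(mulmx1, mul1mx, mulmx0, mul0mx, addr0, add0r).
Qed.

Lemma elementary_product_dl (F : fieldType) (n : nat) (w : 'cV[F]_n) :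
  elementary_product (block_mx 1%:M 0 w 1%:M : 'M[F]_(1 + n)).
Proof.
rewrite [w]matrix_sum_delta.
apply: (big_ind (fun v : 'cV[F]_n =>
  elementary_product (block_mx 1%:M 0 v 1%:M : 'M[F]_(1 + n)))).
- by rewrite -scalar_mx_block; exact: elementary_product1.
- move=> x y ex ey; have := elementary_mul ex ey.
  by rewrite mulmx_block !(mulmx1, mul1mx, mulmx0, mul0mx, addr0, add0r).
move=> i _; rewrite big_ord1.
have := @elementary_shear F (1 + n) (rshift 1 i) (lshift n ord0) (w i 0).
rewrite eq_sym eq_lrshift => /(_ isT).
rewrite delta_mx_dshift delta_mx_lshift scalar_mx_block.
rewrite -[X in col_mx X _]row_mx0 -/(block_mx 0 0 _ 0).
by rewrite scale_block_mx add_block_mx !scaler0 !addr0 add0r.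
Qed.

(** Gaussian elimination.  If the pivot vanishes, a shear adds to the first row
    a row that meets the first column; then the Schur complement is again
    invertible. *)
Lemma unitmx_elementary_product (F : fieldType) (n : nat) (M : 'M[F]_n) :
  M \in unitmx -> elementary_product M.
Proof.
elim: n M => [|n IHn] M Mu.
  by rewrite [M]thinmx0 -[0](thinmx0 1%:M); exact: elementary_product1.
have pivot (N : 'M[F]_(1 + n)) :
    N \in unitmx -> N 0 0 != 0 -> elementary_product N.
  move=> Nu N00; set a := N 0 0 in N00.
  have ulE : ulsubmx N = a%:M.
    rewrite [ulsubmx N]mx11_scalar !mxE; congr (N _ _)%:M; exact: val_inj.
  set v := ursubmx N; set w := dlsubmx N; set S := drsubmx N - w *m (a^-1 *: v).
  have NE : N = (block_mx 1%:M 0 (a^-1 *: w) 1%:M)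
      *m (diag_mx (row_mx a%:M (const_mx 1)) *m
          (block_mx 1%:M 0 0 S *m block_mx 1%:M (a^-1 *: v) 0 1%:M)).
    rewrite diag_mx_row diag_const_mx.
    have -> : diag_mx a%:M = a%:M :> 'M[F]_1.
      by apply/matrixP => i j; rewrite !mxE [i]ord1 [j]ord1.
    rewrite !mulmx_block !(mulmx1, mul1mx, mulmx0, mul0mx, addr0, add0r).
    rewrite -[LHS]submxK ulE -/v -/w; congr block_mx.
    - by rewrite mul_scalar_mx scalerA divff ?scale1r.
    - by rewrite -scalemxAl mul_mx_scalar scalerA mulVf ?scale1r.
    - rewrite mul_scalar_mx scalerA divff// scale1r -scalemxAl.
      by rewrite /S -scalemxAr subrKC.
  have Su : S \in unitmx.
    move: Nu; rewrite {1}NE !unitmxE !det_mulmx.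
    rewrite !unitrM => /andP[_ /andP[_ /andP[+ _]]].
    by rewrite det_ublock det1 mul1r.
  rewrite NE; apply: elementary_mul; first exact: elementary_product_dl.
  apply: elementary_mul.
    apply: elementary_diag => i; rewrite mxE; case: splitP => l _.
      by rewrite mxE [l]ord1 eqxx.
    by rewrite mxE oner_neq0.
  apply: elementary_mul; first exact/elementary_product_dr/IHn.
  rewrite -[block_mx _ _ _ _]trmxK; apply: elementary_product_tr.
  rewrite tr_block_mx !trmx1 trmx0; exact: elementary_product_dl.
have [M00|M00] := eqVneq (M 0 0) 0; last exact: pivot.
have [i Mi0] : exists i, M i 0 != 0.
  apply/existsP; apply: contraLR Mu => /existsPn M0.
  rewrite unitmxE (expand_det_col M 0) big1 ?unitr0// => i _.
  by have /negPn/eqP-> := M0 i; rewrite mul0r.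
have i0 : 0 != i by apply: contraNneq Mi0 => <-; rewrite M00.
(* E (- 1) is the inverse of the shear E 1 that repairs the pivot *)
pose E (c : F) : 'M[F]_(1 + n) := 1%:M + c *: delta_mx 0 i.
have EK : E (- 1) *m E 1 = 1%:M.
  rewrite /E mulmxDl mul1mx mulmxDr mulmx1 scale1r scaleN1r mulNmx.
  by rewrite mul_delta_mx_0 1?eq_sym// subr0 addrK.
have -> : M = E (- 1) *m (E 1 *m M) by rewrite mulmxA EK mul1mx.
apply: elementary_mul.
  exact: elementary_shear.
apply: pivot.
  by rewrite unitmx_mul Mu andbT; case/mulmx1_unit: EK.
rewrite mulmxDl mul1mx scale1r !mxE M00 add0r (bigD1 i)//= big1.
  by rewrite !mxE !eqxx mul1r addr0.
by move=> j ji; rewrite !mxE (negbTE ji) andbF mul0r.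
Qed.

Lemma det_shear (F : fieldType) (n : nat) (i j : 'I_n) (c : F) : i != j ->
  \det (1%:M + c *: delta_mx i j) = 1.
Proof.
wlog ji : i j / (j < i)%N => [IH ij|ij].
  have [ji|] := ltnP j i; first exact: IH.
  rewrite leq_eqVlt val_eqE (negbTE ij)/= => ji.
  by rewrite -det_tr linearD linearZ/= trmx1 trmx_delta IH// eq_sym.
rewrite det_trig.
  apply: big1 => l _; rewrite !mxE eqxx.
  by case: eqP => [->|]; rewrite ?(negbTE ij) mulr0 addr0.
apply/is_trig_mxP => u v uv; rewrite !mxE lt_eqF//= add0r.
case: eqP => [ui|]; last by rewrite mulr0.
case: eqP => [vj|]; last by rewrite mulr0.
by move: uv; rewrite ui vj ltnNge (ltnW ji).
Qed.

(** It suffices to prove an inequality for all invertible matrices: the reverse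
    one is the same inequality for the inverse matrix. *)
Lemma vol_mulmx_le (R : realType) (n : nat) (M : 'M[R]_n) (S : set 'rV[R]_n) :
  (0 < n)%N -> M \in unitmx ->
  (vol [set (x *m M)%R | x in S] <= `|\det M|%:E * vol S)%E.
Proof.
move=> n0 /unitmx_elementary_product Mu.
elim: Mu S => {M} [d d0|i j c ij|M N _ IHM _ IHN] S; first exact: vol_diag_le.
  set M := _ + _.
  have -> : \det M = 1 by exact: det_shear.
  rewrite normr1; apply: vol_image_le => // a b ab.
  by rewrite mul1r; exact: vol_shear_box_le.
rewrite det_mulmx normrM EFinM [(_%:E * _%:E)%E]muleC.
rewrite -muleA.
apply: (@le_trans _ _ (`|\det N|%:E * vol [set (x *m M)%R | x in S])%E).
  apply: le_trans (IHN _); apply: le_vol => _ [x Sx <-].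
  by exists (x *m M); [exists x|rewrite mulmxA].
by apply: lee_wpmul2l; rewrite ?lee_fin ?normr_ge0//; exact: IHM.
Qed.

Lemma vol_affine_map (R : realType) (n : nat) (M : 'M[R]_n) (c : 'rV[R]_n)
    (S : set 'rV[R]_n) : (0 < n)%N -> M \in unitmx ->
  vol (affine_map M c @` S) = (`|\det M|%:E * vol S)%E.
Proof.
move=> n0 Mu.
have -> : affine_map M c @` S = [set x + c | x in [set x *m M | x in S]].
  by rewrite image_comp.
rewrite vol_translate//; apply/eqP; rewrite eq_le vol_mulmx_le//=.
have detM0 : \det M != 0 by rewrite -unitfE -unitmxE.
have -> : vol S = vol [set x *m invmx M | x in [set x *m M | x in S]].
  congr vol; rewrite image_comp -[LHS]image_id; apply: eq_imagel => x _ /=.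
  by rewrite mulmxK.
apply: le_trans (lee_wpmul2l _ (vol_mulmx_le _ n0 _)) _.
- by rewrite lee_fin.
- by rewrite unitmx_inv.
by rewrite muleA -EFinM -normrM det_inv mulfV// normr1 mul1e.
Qed.

(** * The volume of the unit ball is positive and finite *)

(** Induction on the dimension.  For t in [0, 1], the boxes that meet the slice
    x_0 = t cover a unit cube of one dimension less, so that the volumes of
    their slices add up to at least 1; integrate this over t, term by term.
    The selection P is what lets the induction pass to the boxes that meet a
    slice; in dimension 0 it says that some box is selected. *)
Lemma cube_cover_ge1 (R : realType) (n : nat) (P : nat -> bool)
    (a b : nat -> 'rV[R]_n) : (forall j i, a j 0 i <= b j 0 i) ->
  (forall x : 'rV[R]_n, (forall i, 0 <= x 0 i <= 1) ->
     exists2 j, P j & box (a j) (b j) x) ->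
  (1 <= \sum_(0 <= j <oo)
          ((P j)%:R * \prod_(i < n) (b j 0 i - a j 0 i))%:E)%E.
Proof.
elim: n P a b => [|n IHn] P a b ab cover.
  have [|j Pj _] := cover 0; first by case.
  apply: le_trans (nneseries_lim_ge j.+1 _); last first.
    by move=> m _ _; rewrite lee_fin mulr_ge0 ?box_vol_ge0.
  rewrite big_nat_recr//= Pj big_ord0 mulr1 leeDr// sume_ge0// => m _.
  by rewrite lee_fin mulr_ge0 ?box_vol_ge0.
pose side j := `[a j 0 ord0, b j 0 ord0]%classic.
pose v j := (P j)%:R *
  \prod_(i < n) (b j 0 (lift ord0 i) - a j 0 (lift ord0 i)).
have v0 j : 0 <= v j.
  by apply: mulr_ge0 => //; apply: prodr_ge0 => i _; rewrite subr_ge0.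
have slice (t : R) : t \in `[0, 1] ->
    (1 <= \sum_(0 <= j <oo) (v j)%:E * (\1_(side j) t)%:E)%E.
  move=> t01.
  pose tl (x : 'rV[R]_n.+1) : 'rV[R]_n := \row_i x 0 (lift ord0 i).
  have := IHn (fun j => P j && (t \in side j)) (tl \o a) (tl \o b).
  rewrite [leRHS](@eq_eseriesr _ _ (fun j => (v j)%:E * (\1_(side j) t)%:E)%E).
    apply; first by move=> j i; rewrite !mxE.
    move=> y y01; pose x : 'rV[R]_n.+1 := \row_i oapp (y 0) t (unlift ord0 i).
    have [|j Pj xj] := cover x.
      move=> i; rewrite mxE; case: unliftP => [l _|_] /=; first exact: y01.
      by move: t01; rewrite in_itv.
    exists j.
      rewrite Pj inE /side /= in_itv/=.
      by have := xj ord0; rewrite mxE unlift_none.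
    by move=> i; have := xj (lift ord0 i); rewrite !mxE liftK.
  move=> j _; rewrite -EFinM indicE mulrAC -natrM mulnb; congr (_ * _)%:E.
  by apply: eq_bigr => i _; rewrite !mxE.
pose D : set R := `[0, 1]%classic.
have muD : lebesgue_measure D = 1%E.
  by rewrite lebesgue_measure_itv/= lte_fin ltr01 oppr0 adde0.
have mD : measurable D by exact: measurable_itv.
have mside j : measurable (side j) by exact: measurable_itv.
pose f j (t : R) : \bar R := ((v j)%:E * (\1_(side j) t)%:E)%E.
have mf j : measurable_fun D (f j).
  by apply/measurable_EFinP/measurable_funM => //; exact: measurable_indic.
have f0 j (t : R) : D t -> (0 <= f j t)%E.
  by move=> _; rewrite mule_ge0 ?lee_fin.
have le_int : (1 <= \int[lebesgue_measure]_(t in D)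
    \sum_(0 <= j <oo) f j t)%E.
  have <- : (\int[lebesgue_measure]_(t in D) cst 1 t = 1 :> \bar R)%E.
    by rewrite integral_cst// mul1e; exact: muD.
  refine (@ge0_le_integral _ _ R lebesgue_measure D _ (cst 1%E)
    (fun t => \sum_(0 <= j <oo) f j t)%E _ _ _ _).
  - exact: mD.
  - by [].
  - by [].
  - by apply: ge0_emeasurable_sum => *; [exact: f0|exact: mf].
  - by move=> t /slice.
apply: le_trans le_int _; rewrite integral_nneseries//.
apply: lee_nneseries => j _ *.
  by apply: integral_ge0 => t; exact: f0.
rewrite ge0_integralZl_EFin//; last first.
  by apply/measurable_EFinP/measurable_indic; exact: mside.
rewrite integral_indic; [|exact: mD|exact: mside].
rewrite big_ord_recl mulrCA [X in (_ <= X%:E)%E]mulrC [leRHS]EFinM.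
apply: lee_wpmul2l; first by rewrite lee_fin.
apply: (@le_trans _ _ (lebesgue_measure (side j))).
  apply: le_measure; rewrite ?inE; [|exact: mside|exact: subIsetl].
  by apply: measurableI; [exact: mside|exact: mD].
rewrite lebesgue_measure_itv/=; case: ifP => // _.
by rewrite lee_fin subr_ge0.
Qed.

Lemma vol_unit_cube_ge1 (R : realType) (n : nat) :
  (1 <= vol [set x : 'rV[R]_n | forall i, (0 <= x 0%R i <= 1)%R])%E.
Proof.
apply: le_ereal_inf_tmp => _ [a [b [[ab cover] ->]]].
have := @cube_cover_ge1 R n xpredT a b ab.
under eq_eseriesr do rewrite mul1r; apply=> x /cover[j _ xj].
by exists j.
Qed.

Lemma sqr_euclidean_norm (R : realType) (n : nat) (x : 'rV[R]_n) :
  euclidean_norm x ^+ 2 = \sum_(i < n) x 0 i ^+ 2.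
Proof. by rewrite sqr_sqrtr// sumr_ge0// => i _; rewrite sqr_ge0. Qed.

Lemma unit_ballE (R : realType) (n : nat) (x : 'rV[R]_n) :
  unit_ball x <-> \sum_(i < n) x 0 i ^+ 2 <= 1.
Proof.
by rewrite /unit_ball/= -sqr_euclidean_norm expr_le1// sqrtr_ge0.
Qed.

Lemma vol_unit_ball_fin (R : realType) (n : nat) : (0 < n)%N ->
  vol (@unit_ball R n) \is a fin_num.
Proof.
move=> n0; rewrite ge0_fin_numE ?vol_ge0//.
have le11 (i : 'I_n) :
    (const_mx (- 1) : 'rV[R]_n) 0 i <= (const_mx 1 : 'rV[R]_n) 0 i.
  by rewrite !mxE; lra.
apply: le_lt_trans (ltry _); apply: le_trans (vol_box_le n0 le11).
apply: le_vol => x /unit_ballE xB i; rewrite !mxE -ler_norml -(@expr_le1 _ 2)//.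
rewrite real_normK ?num_real//; apply: le_trans xB.
by rewrite (bigD1 i)//= lerDl sumr_ge0// => l _; rewrite sqr_ge0.
Qed.

(** The ball contains a cube of side 1 / n. *)
Lemma vol_unit_ball_gt0 (R : realType) (n : nat) : (0 < n)%N ->
  (0 < vol (@unit_ball R n))%E.
Proof.
move=> n0; have n0' : 0 < n%:R :> R by rewrite ltr0n.
pose M : 'M[R]_n := n%:R^-1%:M.
have detM : 0 < \det M by rewrite det_scalar exprn_gt0// invr_gt0.
have Mu : M \in unitmx by rewrite unitmxE unitfE gt_eqF.
apply: (@lt_le_trans _ _ (vol (affine_map M 0 @`
    [set x : 'rV[R]_n | forall i, 0 <= x 0 i <= 1]))).
  rewrite vol_affine_map//; apply: mule_gt0.
    by rewrite lte_fin normr_gt0 gt_eqF.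
  exact: lt_le_trans (vol_unit_cube_ge1 _ _).
apply: le_vol => _ [x x01 <-]; apply/unit_ballE.
rewrite /affine_map addr0 mul_mx_scalar.
apply: (@le_trans _ _ (\sum_(i < n) n%:R^-1)); last first.
  by rewrite sumr_const card_ord -[leLHS]mulr_natl divff// gt_eqF.
apply: ler_sum => i _; rewrite mxE; have /andP[x0 x1] := x01 i.
have ni : n%:R^-1 <= 1 :> R by rewrite invf_le1// ler1n.
have ni0 : 0 < n%:R^-1 :> R by rewrite invr_gt0.
rewrite exprMn -[leRHS]mulr1 expr2 -mulrA ler_pM2l//.
by apply: mulr_ile1; rewrite ?sqr_ge0 ?exprn_ile1 ?(ltW ni0).
Qed.

(** * Isometries and the LQ decomposition *)

Lemma mulmx_trE (R : realType) (n : nat) (x : 'rV[R]_n) :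
  (x *m x^T) 0 0 = \sum_(i < n) x 0 i ^+ 2.
Proof. by rewrite mxE; apply: eq_bigr => i _; rewrite mxE expr2. Qed.

Lemma unit_ball_mxE (R : realType) (n : nat) (x : 'rV[R]_n) :
  unit_ball x <-> (x *m x^T) 0 0 <= 1.
Proof. by rewrite mulmx_trE; exact: unit_ballE. Qed.

Lemma sqnorm_isometry (R : realType) (p k n : nat) (U : 'M[R]_(k, n))
    (x : 'M[R]_(p, k)) : orthonormal_rows U ->
  (x *m U) *m (x *m U)^T = x *m x^T.
Proof. by move=> UU; rewrite trmx_mul mulmxA -(mulmxA x) UU mulmx1. Qed.

Lemma unit_ball_isometry (R : realType) (k n : nat) (U : 'M[R]_(k, n))
    (x : 'rV[R]_k) : orthonormal_rows U -> unit_ball (x *m U) <-> unit_ball x.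
Proof. by move=> UU; rewrite !unit_ball_mxE sqnorm_isometry. Qed.

Lemma unit_ball_opp (R : realType) (n : nat) (x : 'rV[R]_n) :
  unit_ball x -> unit_ball (- x).
Proof. by rewrite !unit_ball_mxE linearN /= mulmxN mulNmx opprK. Qed.

Lemma unit_ball0 (R : realType) (n : nat) : unit_ball (0 : 'rV[R]_n).
Proof. by apply/unit_ball_mxE; rewrite mul0mx mxE. Qed.

Lemma unit_ball_delta (R : realType) (n : nat) (i : 'I_n) :
  unit_ball (delta_mx 0 i : 'rV[R]_n).
Proof.
apply/unit_ballE; rewrite (bigD1 i)//= big1 => [|l li]; rewrite mxE.
  by rewrite !eqxx expr1n addr0.
by rewrite (negbTE li) andbF expr0n.
Qed.

(** Polar coordinates, without a case distinction at the origin. *)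
Lemma unit_ball_polar (R : realType) (n : nat) (x : 'rV[R]_n) :
  exists2 u, unit_ball u & x = euclidean_norm x *: u.
Proof.
have [x0|x0] := eqVneq (euclidean_norm x) 0.
  exists 0; first exact: unit_ball0.
  rewrite scaler0; apply/rowP => i; rewrite mxE.
  have := sqr_euclidean_norm x; rewrite x0 expr0n /= => /esym/eqP.
  rewrite psumr_eq0 => [/allP/(_ i)|l _]; last exact: sqr_ge0.
  by rewrite mem_index_enum sqrf_eq0 => /(_ isT)/eqP.
exists ((euclidean_norm x)^-1 *: x); last by rewrite scalerA divff// scale1r.
apply/unit_ballE; under eq_bigr do rewrite mxE exprMn.
by rewrite -mulr_sumr -sqr_euclidean_norm -exprMn mulVf// expr1n.
Qed.

Lemma orthonormal_rows1 (R : realType) (n : nat) :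
  orthonormal_rows (1%:M : 'M[R]_n).
Proof. by rewrite /orthonormal_rows trmx1 mulmx1. Qed.

Lemma orthonormal_rows_sqr (R : realType) (n : nat) (U : 'M[R]_n) :
  orthonormal_rows U -> U \in unitmx /\ `|\det U| = 1.
Proof.
move=> UU; split; first by case/mulmx1_unit: UU.
have := congr1 determinant UU; rewrite det_mulmx det_tr det1 -expr2 => detU.
by apply/eqP; rewrite -sqrp_eq1// real_normK ?num_real// detU.
Qed.

(** Reflect in the hyperplane that swaps v and the multiple of the first basis
    vector of the same length. *)
Lemma exists_reflection (R : realType) (n : nat) (v : 'rV[R]_n.+1) :
  exists (U : 'M[R]_n.+1) (r : R),
    orthonormal_rows U /\ v *m U = r *: delta_mx 0 0.
Proof.
pose e : 'rV[R]_n.+1 := delta_mx 0 0.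
pose r := euclidean_norm v; pose w := v - r *: e.
have [w0|w0] := eqVneq w 0.
  exists 1%:M, r; split; first exact: orthonormal_rows1.
  by rewrite mulmx1; apply/eqP; rewrite -subr_eq0 -/e -/w w0.
pose q := (w *m w^T) 0 0.
have wwT : w *m w^T = q%:M by exact: mx11_scalar.
have q0 : q != 0.
  apply: contraNneq w0 => q0; apply/eqP/rowP => i; rewrite [RHS]mxE.
  have := q0; rewrite /q mulmx_trE => /eqP.
  rewrite psumr_eq0 => [/allP/(_ i)|l _]; last exact: sqr_ge0.
  by rewrite mem_index_enum sqrf_eq0 => /(_ isT)/eqP.
pose U := 1%:M - (2 / q) *: (w^T *m w).
have UT : U^T = U by rewrite linearB linearZ /= trmx1 trmx_mul trmxK.
have vwT : v *m w^T = (q / 2)%:M.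
  rewrite [LHS]mx11_scalar; congr (_%:M).
  have vw : (v *m w^T) 0 0 = r ^+ 2 - r * v 0 0.
    rewrite linearB linearZ /= mulmxBr -scalemxAr trmx_delta -colE.
    by rewrite mxE mulmx_trE -sqr_euclidean_norm !mxE.
  have : q = (v *m w^T) 0 0 - r * (v 0 0 - r).
    by rewrite /q {1}/w mulmxBl -scalemxAl -rowE !mxE !eqxx mulr1.
  by rewrite vw => ->; field.
exists U, r; split.
  have PP : (w^T *m w) *m (w^T *m w) = q *: (w^T *m w).
    by rewrite mulmxA -(mulmxA w^T) wwT mul_mx_scalar scalemxAl.
  rewrite /orthonormal_rows UT /U; move: (w^T *m w) PP => P PP.
  rewrite mulmxBl mul1mx mulmxBr mulmx1.
  rewrite -scalemxAl -scalemxAr PP !scalerA.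
  have -> : 2 / q * (2 / q) * q = 2 / q + 2 / q by field.
  by rewrite scalerDl opprB addrK subrK.
rewrite mulmxBr mulmx1 -scalemxAr mulmxA vwT mul_scalar_mx scalerA.
rewrite [_ * _](_ : _ = 1); last by field.
by rewrite scale1r /w opprB addrC subrK.
Qed.

(** Reflect the first row onto the first axis, then recurse on the remaining
    rows and columns. *)
Lemma lq_decomposition (R : realType) (k n : nat) (A : 'M[R]_(k, n)) :
  exists (L : 'M[R]_(k, n)) (U : 'M[R]_n),
    [/\ is_trig_mx L, orthonormal_rows U & A = L *m U].
Proof.
elim: k n A => [|k IHk] [|n] A.
- exists 0, 1%:M; split; last by rewrite mulmx1 [A]flatmx0.
    by apply/is_trig_mxP => -[].
  exact: orthonormal_rows1.
- exists 0, 1%:M; split; last by rewrite mulmx1 [A]flatmx0.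
    by apply/is_trig_mxP => -[].
  exact: orthonormal_rows1.
- exists 0, 1%:M; split; last by rewrite mulmx1 [A]thinmx0.
    by apply/is_trig_mxP => i [].
  exact: orthonormal_rows1.
have [U1 [r [U1o vU1]]] := exists_reflection (row 0 A).
pose B : 'M[R]_(1 + k, 1 + n) := A *m U1.
have B0 j : B 0 j = (r *: delta_mx 0 0 : 'rV_(1 + n)) 0 j.
  by have := congr1 (fun x : 'rV_n.+1 => x 0 j) vU1; rewrite -row_mul mxE.
have [L [U [Ltrig Uo BE]]] := IHk n (drsubmx B).
pose L' : 'M[R]_(1 + k, 1 + n) := block_mx r%:M 0 (dlsubmx B) L.
pose U' : 'M[R]_(1 + n) := block_mx 1%:M 0 0 U.
have L't : is_trig_mx L'.
  by rewrite is_trig_block_mx// eqxx scalar_mx_is_trig.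
have U'o : orthonormal_rows U'.
  rewrite /orthonormal_rows tr_block_mx !trmx1 !trmx0 mulmx_block.
  by rewrite !(mulmx0, mul0mx, addr0, add0r, mulmx1) Uo -scalar_mx_block.
exists L', (U' *m U1^T); split.
- exact: L't.
- rewrite /orthonormal_rows trmx_mul trmxK mulmxA -(mulmxA U').
  by rewrite (mulmx1C U1o) mulmx1.
have BL : B = L' *m U'.
  rewrite mulmx_block !(mulmx0, mul0mx, addr0, add0r, mulmx1) -BE.
  rewrite -[LHS]submxK; congr block_mx.
    apply/matrixP => i j; rewrite [i]ord1 [j]ord1.
    rewrite [LHS]mxE [LHS]mxE lshift0 B0 !mxE.
    by rewrite mulr1.
  apply/matrixP => i j; rewrite [i]ord1 [LHS]mxE [LHS]mxE lshift0 B0 !mxE.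
  by rewrite mulr0.
by rewrite mulmxA -BL -mulmxA U1o mulmx1.
Qed.

(** * Convex combinations of the ball and an ellipsoid *)

Lemma convex_set_combination (R : realType) (n : nat) (K : set 'rV[R]_n) :
  convex_set (K : set (convex_lmodType 'rV[R]_n)) ->
  forall x y (t : R), 0 <= t <= 1 -> K x -> K y -> K (t *: x + (1 - t) *: y).
Proof.
move=> cK x y t /andP[t0 t1] Kx Ky.
have := cK x y (Itv01 t0 t1); rewrite !inE => /(_ Kx Ky).
by [].
Qed.

(** Bernoulli's inequality for unequal factors: the terms left out are
    nonnegative. *)
Lemma ler_bernoulli_prod (R : realFieldType) (k : nat) (s : R) (x : 'I_k -> R) :
  0 <= s -> (forall i, 0 <= x i) ->
  1 + s * \sum_(i < k) x i <= \prod_(i < k) (1 + s * x i).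
Proof.
elim: k x => [|k IHk] x s0 x0; first by rewrite !big_ord0 mulr0 addr0.
rewrite !big_ord_recl /=.
have := IHk (fun i => x (lift ord0 i)) s0 (fun i => x0 _).
set S := \sum_(i < k) _; set P := \prod_(i < k) _ => SP.
have S0 : 0 <= S by apply: sumr_ge0 => i _.
apply: le_trans (_ : (1 + s * x ord0) * (1 + s * S) <= _).
  have : 0 <= (s * x ord0) * (s * S) by rewrite !mulr_ge0.
  lra.
by apply: ler_wpM2l => //; rewrite addr_ge0 ?mulr_ge0.
Qed.

(** The derivative of (1 + s)^n at s = 0 is n. *)
Lemma le_of_Bernoulli_bound (R : realFieldType) (n : nat) (X : R) :
  (forall s : R, 0 < s -> 1 + s * X <= (1 + s) ^+ n) -> X <= n%:R.
Proof.
move=> bound.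
have [C C0 expand] : exists2 C : R, 0 <= C &
    forall s : R, 0 <= s <= 1 -> (1 + s) ^+ n <= 1 + n%:R * s + C * s ^+ 2.
  elim: n {bound} => [|n [C C0 IHn]].
    by exists 0 => // s _; rewrite expr0 mul0r mul0r !addr0.
  exists (n%:R + 2 * C) => [|s s01]; first by rewrite addr_ge0 ?mulr_ge0.
  have /andP[s0 s1] := s01; have s2 : 0 <= s ^+ 2 by rewrite exprn_ge0.
  rewrite exprS; apply: le_trans (ler_wpM2l _ (IHn _ s01)) _; first by lra.
  have : C * s ^+ 2 * s <= C * s ^+ 2 * 1.
    by apply: ler_wpM2l => //; rewrite mulr_ge0.
  by rewrite -natr1; lra.
rewrite leNgt; apply/negP => nX; set d := X - n%:R.
have d0 : 0 < d by rewrite subr_gt0.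
have dC : 0 < d + C + 1 by lra.
(* small enough for C s < d *)
set s := d / (d + C + 1); have s0 : 0 < s by rewrite divr_gt0.
have s1 : s <= 1 by rewrite ler_pdivrMr//; lra.
have := le_trans (bound s s0) (expand s _).
rewrite (ltW s0) s1 => /(_ isT) le_s.
have : d * s <= (C * s) * s by move: le_s; rewrite /d expr2; lra.
rewrite ler_pM2r// leNgt => /negP; apply.
have ds : d = s * (d + C + 1) by rewrite /s divfK// gt_eqF.
have : 0 < s * (d + 1) by rewrite mulr_gt0//; lra.
by move: ds; lra.
Qed.

(** Write x = p u and t = q v with unit vectors u and v: then a p + b q <= 1 by
    Cauchy-Schwarz, and 0 takes the remaining weight. *)
Lemma convex_l2_combination (R : realType) (k n : nat) (L : set 'rV[R]_n)
    (A : 'M[R]_(k, n)) (a b : R) (x : 'rV[R]_n) (t : 'rV[R]_k) :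
  (forall x y (s : R), 0 <= s <= 1 -> L x -> L y ->
     L (s *: x + (1 - s) *: y)) ->
  @unit_ball R n `<=` L -> (forall t, unit_ball t -> L (t *m A)) ->
  0 <= a -> 0 <= b -> a ^+ 2 + b ^+ 2 = 1 ->
  (x *m x^T) 0 0 + (t *m t^T) 0 0 <= 1 ->
  L (a *: x + b *: (t *m A)).
Proof.
move=> cL BL AL a0 b0 ab1; rewrite !mulmx_trE -!sqr_euclidean_norm => xt1.
have [u Bu xE] := unit_ball_polar x; have [v Bv tE] := unit_ball_polar t.
rewrite {1}xE {1}tE.
have : 0 <= euclidean_norm x by exact: sqrtr_ge0.
have : 0 <= euclidean_norm t by exact: sqrtr_ge0.
move: (euclidean_norm x) (euclidean_norm t) xt1 {xE tE}.
move=> p q pq1 q0 p0.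
rewrite -scalemxAl !scalerA; set w := a * p; set z := b * q.
have w0 : 0 <= w by exact: mulr_ge0.
have z0 : 0 <= z by exact: mulr_ge0.
have wz1 : w + z <= 1.
  have := sqr_ge0 (a - p); have := sqr_ge0 (b - q); rewrite /w /z; nra.
have Lu := BL _ Bu; have Lv := AL _ Bv; have L0 := BL _ (unit_ball0 R n).
have [wz0|wz0] := eqVneq (w + z) 0.
  have [-> ->] : w = 0 /\ z = 0 by lra.
  by rewrite !scale0r addr0.
have wz_gt0 : 0 < w + z by rewrite lt_neqAle eq_sym wz0 addr_ge0.
have Luv : L ((w / (w + z)) *: u + (1 - w / (w + z)) *: (v *m A)).
  apply: cL => //; rewrite divr_ge0 ?(ltW wz_gt0)//=.
  by rewrite ler_pdivrMr// mul1r lerDl.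
have := cL _ _ (w + z) _ Luv L0; rewrite (ltW wz_gt0) wz1 => /(_ isT).
rewrite scaler0 addr0 scalerDr !scalerA.
by congr (L (_ *: _ + _ *: _)); field.
Qed.

(** * Variation of the John ellipsoid *)

(** The ellipsoids used here are the images of the ball under the matrices M of
    the proof, which send (y1, y2) to a x + b t A with x = (al y1, y2) and
    t = be y1, where al^2 + be^2 = 1 in each coordinate, so that
    |x|^2 + |t|^2 = |y|^2.  Among those al and be, the ones proportional to a
    and b T_ii make the diagonal entry a al + b be T_ii largest. *)
Lemma john_sum_sqr_le (R : realType) (k m : nat) (L : set 'rV[R]_(k + m))
    (T : 'M[R]_k) (U : 'M[R]_(k + m)) :
  (forall x y (s : R), 0 <= s <= 1 -> L x -> L y ->
     L (s *: x + (1 - s) *: y)) ->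
  @unit_ball R (k + m) `<=` L ->
  (forall M : 'M[R]_(k + m), M \in unitmx ->
     (forall y, unit_ball y -> L (y *m M)) -> `|\det M| <= 1) ->
  is_trig_mx T -> orthonormal_rows U ->
  (forall t, unit_ball t -> L (t *m (row_mx T 0 *m U))) ->
  \sum_(i < k) T i i ^+ 2 <= (k + m)%:R.
Proof.
move=> cL BL detL Ttrig Uo TL; apply: le_of_Bernoulli_bound => s s0.
have s1 : 0 < 1 + s by rewrite addr_gt0.
have s1' : 1 + s != 0 by rewrite gt_eqF.
(* b ^+ 2 / a ^+ 2 = s *)
pose a := Num.sqrt (1 + s)^-1; pose b := Num.sqrt (s / (1 + s)).
have aE : a ^+ 2 = (1 + s)^-1 by rewrite sqr_sqrtr// invr_ge0 (ltW s1).
have bE : b ^+ 2 = s / (1 + s).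
  by rewrite sqr_sqrtr// divr_ge0// (ltW s0, ltW s1).
have a0 : 0 < a by rewrite sqrtr_gt0 invr_gt0.
have ab1 : a ^+ 2 + b ^+ 2 = 1 by rewrite aE bE; field.
pose rho i := Num.sqrt (a ^+ 2 + b ^+ 2 * T i i ^+ 2).
have rhoE i : rho i ^+ 2 = a ^+ 2 + b ^+ 2 * T i i ^+ 2.
  by rewrite sqr_sqrtr// addr_ge0// ?sqr_ge0// mulr_ge0// sqr_ge0.
have rho_gt0 i : 0 < rho i.
  rewrite sqrtr_gt0 ltr_pwDl ?exprn_gt0//.
  by rewrite mulr_ge0// sqr_ge0.
have rho0 i : rho i != 0 by rewrite gt_eqF.
pose al : 'rV[R]_k := \row_i (a / rho i).
pose be : 'rV[R]_k := \row_i (b * T i i / rho i).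
have albe i : al 0 i ^+ 2 + be 0 i ^+ 2 = 1.
  rewrite !mxE !exprMn !exprVn -mulrDl -rhoE divff//.
  by rewrite expf_neq0.
pose D := a *: diag_mx al + b *: (diag_mx be *m T).
have DE i j : D i j = a * (al 0 i *+ (i == j)) + b * (be 0 i * T i j).
  by rewrite mxE [X in X + _]mxE mul_diag_mx !mxE.
have detD : \det D = \prod_i rho i.
  rewrite det_trig.
    apply: eq_bigr => i _; rewrite DE eqxx mulr1n !mxE.
    have -> : a * (a / rho i) + b * (b * T i i / rho i * T i i) =
      rho i ^+ 2 / rho i by rewrite rhoE; field.
    by field.
  apply/is_trig_mxP => i j ij; rewrite DE (is_trig_mxP Ttrig _ _ ij).
  by rewrite -val_eqE ltn_eqF// !mulr0 addr0.
pose M : 'M[R]_(k + m) := block_mx D 0 0 a%:M *m U.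
have detM : `|\det M| = `|(\prod_i rho i) * a ^+ m|.
  rewrite det_mulmx normrM (orthonormal_rows_sqr Uo).2 mulr1.
  by rewrite det_ublock detD det_scalar.
have : `|\det M| <= 1.
  apply: detL => [|y By].
    rewrite unitmxE unitfE -normr_eq0 detM normr_eq0 gt_eqF// mulr_gt0//.
      by apply: prodr_gt0 => i _.
    exact: exprn_gt0.
  pose y1 := lsubmx y; pose y2 := rsubmx y.
  have -> : y *m M = a *: (row_mx (y1 *m diag_mx al) y2 *m U) +
      b *: ((y1 *m diag_mx be) *m (row_mx T 0 *m U)).
    rewrite !mulmxA !scalemxAl -mulmxDl; congr (_ *m _).
    rewrite -{1}[y]hsubmxK -/y1 -/y2 mul_row_block !mulmx0 addr0 add0r.
    rewrite mul_mx_row mulmx0 scale_row_mx add_row_mx addr0.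
    by rewrite mul_mx_scalar mulmxDr -!scalemxAl -!scalemxAr mulmxA.
  apply: convex_l2_combination => //; [exact: ltW|exact: sqrtr_ge0|].
  rewrite sqnorm_isometry//; move: By => /unit_ballE; apply: le_trans.
  rewrite !mulmx_trE !big_split_ord/= addrAC -big_split/= le_eqVlt.
  apply/orP; left; apply/eqP; congr (_ + _); apply: eq_bigr => i _.
    rewrite row_mxEl !mul_mx_diag !mxE !exprMn -mulrDr.
    by have := albe i; rewrite !mxE !exprMn => ->; rewrite mulr1.
  by rewrite row_mxEr mxE.
rewrite detM -(@expr_le1 _ 2)// real_normK ?num_real// exprMn -prodrXl.
under eq_bigr do rewrite rhoE.
have -> : \prod_(i < k) (a ^+ 2 + b ^+ 2 * T i i ^+ 2) =
    (1 + s)^-1 ^+ k * \prod_(i < k) (1 + s * T i i ^+ 2).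
  transitivity (\prod_(i < k) ((1 + s)^-1 * (1 + s * T i i ^+ 2))).
    by apply: eq_bigr => i _; rewrite aE bE; field.
  by rewrite big_split /= prodr_const card_ord.
rewrite exprAC aE mulrAC -exprD exprVn mulrC ler_pdivrMr ?exprn_gt0// mul1r.
apply: le_trans; apply: ler_bernoulli_prod => [|i]; first exact: ltW.
exact: sqr_ge0.
Qed.

Lemma john_det_le (R : realType) (k m : nat) (T : 'M[R]_k) : (0 < k)%N ->
  is_trig_mx T -> \sum_(i < k) T i i ^+ 2 <= (k + m)%:R ->
  `|\det T| <= Num.sqrt ((k + m)%:R / k%:R) ^+ k.
Proof.
move=> k0 Ttrig sumT; have k0' : 0 < k%:R :> R by rewrite ltr0n.
rewrite -ler_sqr ?nnegrE ?exprn_ge0 ?sqrtr_ge0//.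
rewrite real_normK ?num_real// exprAC sqr_sqrtr ?divr_ge0//.
rewrite det_trig// -prodrXl.
have [le_agm _] := @leif_AGM R 'I_k predT (fun i => T i i ^+ 2)
  (fun i _ => sqr_ge0 _).
apply: le_trans le_agm _; rewrite cardT size_enum_ord.
apply: lerXn2r; rewrite ?nnegrE; last by rewrite ler_pM2r ?invr_gt0.
  by rewrite divr_ge0// sumr_ge0// => i _; rewrite sqr_ge0.
by rewrite divr_ge0.
Qed.

(** * Volume in a flat *)

Lemma flat_vol_le (R : realType) (k n : nat) (Q : 'M[R]_(k, n)) (c : 'rV[R]_n)
    (S : set 'rV[R]_k) : orthonormal_rows Q ->
  (flat_vol k (affine_map Q c @` S) <= vol S)%E.
Proof.
move=> Qo; apply: ereal_inf_lbound; exists Q, c; split => //.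
  by move=> _ [x _ <-]; exists x.
congr vol; apply/seteqP; split => [x Sx|x [y Sy]]; first by exists x.
rewrite /affine_map => /addIr /(congr1 (mulmx^~ Q^T)).
by rewrite -!mulmxA Qo !mulmx1 => <-.
Qed.

(** Two isometric charts of the same k-flat differ by a rigid motion of the
    parameter space, and rigid motions preserve volume. *)
Lemma flat_vol_isometry (R : realType) (k n : nat) (Q : 'M[R]_(k, n))
    (c : 'rV[R]_n) (S : set 'rV[R]_k) : (0 < k)%N -> orthonormal_rows Q ->
  @unit_ball R k `<=` S -> flat_vol k (affine_map Q c @` S) = vol S.
Proof.
move=> k0 Qo BS; apply/eqP; rewrite eq_le flat_vol_le//=.
apply: le_ereal_inf_tmp => _ [A [d [Ao SA ->]]].
have [y0 _ cE] : range (affine_map A d) c.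
  apply: SA; exists 0; first exact/BS/unit_ball0.
  by rewrite /affine_map mul0mx add0r.
(* the linear part of the change of charts *)
pose W := Q *m A^T.
have WA : W *m A = Q.
  apply/row_matrixP => i; rewrite !rowE.
  have [y _] : range (affine_map A d) (delta_mx 0 i *m Q + c).
    by apply: SA; exists (delta_mx 0 i) => //; exact/BS/unit_ball_delta.
  rewrite -cE /affine_map addrA => /addIr yE.
  have QE : delta_mx 0 i *m Q = (y - y0) *m A by rewrite mulmxBl yE addrK.
  by rewrite /W !mulmxA QE -(mulmxA _ A) Ao mulmx1.
have Wo : orthonormal_rows W.
  rewrite /orthonormal_rows /W trmx_mul trmxK mulmxA -/W.
  by rewrite WA Qo.
have [Wu detW] := orthonormal_rows_sqr Wo.
have <- : vol (affine_map W y0 @` S) = vol S.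
  by rewrite vol_affine_map// detW mul1e.
apply: le_vol => _ [x Sx <-]; exists x => //.
by rewrite /affine_map mulmxDl -mulmxA WA -addrA -cE.
Qed.

(** * Frames with columns of equal length *)

(** A Givens rotation moves two columns; the tangent of its angle is a root of
    a quadratic whose discriminant is positive because the target value lies
    strictly between the two squared lengths. *)
Lemma rotate_two_columns (R : rcfType) (di dj p tau : R) :
  di < tau -> tau < dj ->
  exists c s : R, c ^+ 2 + s ^+ 2 = 1 /\
    c ^+ 2 * di + s ^+ 2 * dj + 2 * c * s * p = tau.
Proof.
move=> di_tau tau_dj; have A0 : 0 < dj - tau by rewrite subr_gt0.
have A0' : dj - tau != 0 by rewrite gt_eqF.
pose disc := p ^+ 2 - (dj - tau) * (di - tau).
have disc0 : 0 <= disc.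
  by rewrite subr_ge0; apply: le_trans (sqr_ge0 p); nra.
pose t := (Num.sqrt disc - p) / (dj - tau).
have root : (dj - tau) * t ^+ 2 + 2 * p * t + (di - tau) = 0.
  have tE : (dj - tau) * t + p = Num.sqrt disc by rewrite /t; field.
  have : ((dj - tau) * t + p) ^+ 2 = disc by rewrite tE sqr_sqrtr.
  move=> sq; apply: (mulfI A0'); rewrite mulr0; move: sq; rewrite /disc; lra.
have t1 : 0 < 1 + t ^+ 2 by have := sqr_ge0 t; lra.
have t1' : 1 + t ^+ 2 != 0 by rewrite gt_eqF.
pose c := Num.sqrt (1 + t ^+ 2)^-1.
have cE : c ^+ 2 = (1 + t ^+ 2)^-1 by rewrite sqr_sqrtr// invr_ge0 ltW.
exists c, (t * c); split.
  by rewrite exprMn cE; field.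
have -> : c ^+ 2 * di + (t * c) ^+ 2 * dj + 2 * c * (t * c) * p =
  c ^+ 2 * (di + t ^+ 2 * dj + 2 * t * p) by ring.
have -> : di + t ^+ 2 * dj + 2 * t * p = tau * (1 + t ^+ 2).
  by move: root; lra.
by rewrite cE; field.
Qed.

(** Equal-norm tight frames: rotate pairs of columns until all of them have the
    mean squared length; each rotation settles at least one more column. *)
Lemma equal_norm_frame (R : rcfType) (k n : nat) : (0 < n)%N -> (k <= n)%N ->
  exists Q : 'M[R]_(k, n), Q *m Q^T = 1%:M /\
    forall j, \sum_(u < k) Q u j ^+ 2 = k%:R / n%:R.
Proof.
move=> n0 kn; set tau := k%:R / n%:R.
pose bad (Q : 'M[R]_(k, n)) := [pred j | \sum_(u < k) Q u j ^+ 2 != tau].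
suff step (N : nat) (Q : 'M[R]_(k, n)) : Q *m Q^T = 1%:M -> (#|bad Q| <= N)%N ->
    exists Q : 'M[R]_(k, n), Q *m Q^T = 1%:M /\
      forall j, \sum_(u < k) Q u j ^+ 2 = tau.
  apply: (step _ (pid_mx k) _ (leqnn _)).
  rewrite tr_pid_mx mul_pid_mx minnn (minn_idPr kn).
  exact: pid_mx_1.
elim: N Q => [|N IHN] Q Qo.
  rewrite leqn0 => /eqP/card0_eq bad0; exists Q; split => // j.
  by have := bad0 j; rewrite inE => /negbFE/eqP.
move=> badN; pose d j := \sum_(u < k) Q u j ^+ 2.
have sumd : \sum_j (d j - tau) = 0.
  rewrite sumrB sumr_const card_ord exchange_big /=.
  have -> : \sum_(u < k) \sum_(j < n) Q u j ^+ 2 = \sum_(u < k) 1.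
    apply: eq_bigr => u _; have := congr1 (fun M : 'M[R]_k => M u u) Qo.
    rewrite !mxE eqxx => QQ; rewrite -[RHS]/(true%:R) -QQ.
    by apply: eq_bigr => j _; rewrite mxE expr2.
  rewrite sumr_const card_ord -[tau *+ n]mulr_natr /tau divfK ?subrr//.
  by rewrite pnatr_eq0 -lt0n.
have good : (forall l, d l = tau) -> exists Q : 'M[R]_(k, n),
    Q *m Q^T = 1%:M /\ forall j, \sum_(u < k) Q u j ^+ 2 = tau by exists Q.
have [/existsP[i di]|/existsPn noi] := boolP [exists i, d i < tau]; last first.
  apply: good => l; apply/eqP; rewrite -subr_eq0.
  move/eqP: sumd; rewrite psumr_eq0 => [/allP/(_ l)|u _].
    by rewrite mem_index_enum => /(_ isT).
  by rewrite subr_ge0 leNgt noi.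
have [/existsP[j dj]|/existsPn noj] := boolP [exists j, tau < d j]; last first.
  apply: good => l; apply/eqP; rewrite eq_sym -subr_eq0.
  move/eqP: sumd; rewrite -oppr_eq0 -sumrN psumr_eq0 => [/allP/(_ l)|u _].
    by rewrite mem_index_enum opprB => /(_ isT).
  by rewrite opprB subr_ge0 leNgt noj.
have ij : i != j by apply: contraTneq di => ->; rewrite -leNgt ltW.
have [c [s [cs1 cstau]]] :=
  rotate_two_columns (\sum_(u < k) Q u i * Q u j) di dj.
pose Q' : 'M[R]_(k, n) := \matrix_(u, l)
  (if l == i then c * Q u i + s * Q u j else
   if l == j then c * Q u j - s * Q u i else Q u l).
apply: (IHN Q').
  rewrite -Qo; apply/matrixP => u v; rewrite !mxE.
  rewrite (bigD1 i)//= (bigD1 j) 1?eq_sym//=.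
  rewrite [RHS](bigD1 i)//= [in RHS](bigD1 j) 1?eq_sym//=.
  rewrite !addrA; congr (_ + _).
    rewrite !mxE !eqxx eq_sym (negbTE ij).
    have -> : Q u i * Q v i + Q u j * Q v j =
      (c ^+ 2 + s ^+ 2) * (Q u i * Q v i + Q u j * Q v j) by rewrite cs1 mul1r.
    by ring.
  by apply: eq_bigr => l /andP[/negbTE li /negbTE lj]; rewrite !mxE li lj.
have Q'i : \sum_(u < k) Q' u i ^+ 2 = tau.
  rewrite -cstau /d !mulr_sumr -!big_split /=.
  by apply: eq_bigr => u _; rewrite mxE eqxx; ring.
rewrite -ltnS; apply: leq_trans badN; apply/proper_card/properP; split.
  apply/fintype.subsetP => l; rewrite !inE.
  have [->|li] := eqVneq l i; first by rewrite Q'i eqxx.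
  have [-> _|lj] := eqVneq l j; first by rewrite gt_eqF.
  by under eq_bigr do rewrite mxE (negbTE li) (negbTE lj).
by exists i; rewrite inE ?Q'i ?eqxx// lt_eqF.
Qed.

(** * The upper bound *)

Lemma vol_scaled_ball (R : realType) (k : nat) (r : R) : (0 < k)%N -> 0 < r ->
  vol [set r *: x | x in @unit_ball R k] =
  ((r ^+ k)%:E * vol (@unit_ball R k))%E.
Proof.
move=> k0 r0.
have -> : [set r *: x | x in @unit_ball R k] =
    affine_map r%:M 0 @` unit_ball (n:=k).
  by apply: eq_imagel => x _; rewrite /affine_map addr0 mul_mx_scalar.
rewrite vol_affine_map ?det_scalar ?gtr0_norm ?exprn_gt0//.
by rewrite unitmxE det_scalar unitfE gt_eqF ?exprn_gt0.
Qed.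

Lemma centrally_symmetric_reflect (R : realType) (n : nat) (K : set 'rV[R]_n) :
  centrally_symmetric K ->
  exists p, forall x, K (x + p) -> K (- x + p).
Proof.
case=> p symK; exists p => x Kx.
have : [set z - p | z in K] x by exists (x + p) => //; rewrite addrK.
by rewrite symK => -[z Kz <-]; rewrite opprB subrK.
Qed.

(** The chart given by the first k rows of the orthogonal factor of A reads E as
    the image of the ball under the triangular factor. *)
Lemma flat_vol_ellipsoid_le (R : realType) (k m : nat)
    (K E : set 'rV[R]_(k + m)) :
  (0 < k)%N -> convex_body K -> centrally_symmetric K ->
  john_ellipsoid K (@unit_ball R (k + m)) -> ellipsoid k E -> E `<=` K ->
  (flat_vol k E <=
   vol [set (Num.sqrt ((k + m)%:R / k%:R) : R) *: x | x in @unit_ball R k])%E.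
Proof.
move=> k0 [_ /convex_set_combination cK _].
move=> /centrally_symmetric_reflect[p symK] [_ BK maxK] [A [c [Ainj EE]]] EK.
have n0 : (0 < k + m)%N by rewrite addn_gt0 k0.
pose L : set 'rV[R]_(k + m) := [set x | K (x + p)].
have cL x y (s : R) : 0 <= s <= 1 -> L x -> L y -> L (s *: x + (1 - s) *: y).
  move=> s01 Lx Ly; have := cK _ _ s s01 Lx Ly.
  have sE : s + (1 - s) = 1 by ring.
  by rewrite /L /= !scalerDr addrACA -(scalerDl p) sE scale1r.
have halfE (x y : 'rV[R]_(k + m)) : L (x + y) -> L (x - y) -> L x.
  move=> Lp Lm; have := cL _ _ (1 / 2) _ Lp Lm.
  have -> : 1 - 1 / 2 = 1 / 2 :> R by lra.
  rewrite -scalerDr addrACA subrr addr0 -mulr2n -[x *+ 2]scaler_nat scalerA.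
  have -> : 1 / 2 * 2 = 1 :> R by field.
  by rewrite scale1r; apply; lra.
have symL x : L x -> L (- x) by exact: symK.
have BL : @unit_ball R (k + m) `<=` L.
  move=> x Bx; apply: (halfE x p); last by rewrite /L /= subrK; exact: BK.
  rewrite -[x + p]opprK opprD; apply: symL; rewrite /L /= subrK.
  exact/BK/unit_ball_opp.
(* translating back by p turns y |-> y *m M into an n-ellipsoid of K *)
have detL (M : 'M[R]_(k + m)) : M \in unitmx ->
    (forall y, unit_ball y -> L (y *m M)) -> `|\det M| <= 1.
  move=> Mu ML; rewrite -lee_fin.
  have volB0 := vol_unit_ball_gt0 R n0.
  have /fineK volBE := vol_unit_ball_fin R n0.
  rewrite -(@lee_pmul2r _ (vol (@unit_ball R (k + m))))//; last first.
    by rewrite -volBE.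
  rewrite -(vol_affine_map p)// mul1e; apply: maxK.
    exists M, p; split => // x y; rewrite /affine_map => /addIr.
    exact: (can_inj (mulmxK Mu)).
  by move=> _ [x Bx <-]; exact: ML.
have AL t : unit_ball t -> L (t *m A).
  have ELp u : unit_ball u -> L (u *m A + (c - p)).
    move=> Bu; rewrite /L /= addrA subrK; apply: EK; rewrite EE.
    by exists u.
  move=> Bt; apply: (halfE _ (c - p)); first exact: ELp.
  rewrite -[_ - (c - p)]opprK opprD opprK -mulNmx; apply: symL.
  exact/ELp/unit_ball_opp.
have [T0 [U [T0trig Uo AE0]]] := lq_decomposition A.
pose T := lsubmx T0.
have Ttrig : is_trig_mx T.
  by apply/is_trig_mxP => i j ij; rewrite mxE (is_trig_mxP T0trig).
have AE : A = row_mx T 0 *m U.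
  rewrite AE0 -{1}[T0]hsubmxK; congr (row_mx _ _ *m _).
  apply/matrixP => i j; rewrite [LHS]mxE (is_trig_mxP T0trig) ?mxE//=.
  by apply: leq_trans (ltn_ord i) _; rewrite leq_addr.
have detT : `|\det T| <= Num.sqrt ((k + m)%:R / k%:R) ^+ k.
  apply: john_det_le => //; apply: (john_sum_sqr_le cL BL detL Ttrig Uo).
  by rewrite -AE.
have Tu : T \in unitmx.
  rewrite -row_free_unit; apply/inj_row_free => v vT0.
  apply: Ainj.
  by rewrite /affine_map AE mulmxA mul_mx_row vT0 mulmx0 row_mx0 !mul0mx.
pose Q := row_mx 1%:M 0 *m U : 'M[R]_(k, k + m).
have Qo : orthonormal_rows Q.
  rewrite /orthonormal_rows sqnorm_isometry//.
  by rewrite tr_row_mx mul_row_col trmx1 mulmx1 mul0mx addr0.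
have {EE} -> : E = affine_map Q c @` (affine_map T 0 @` unit_ball (n:=k)).
  rewrite EE image_comp; apply: eq_imagel => x _ /=.
  by rewrite /affine_map addr0 AE /Q !mulmxA !mul_mx_row !mulmx0 mulmx1.
apply: le_trans (flat_vol_le _ _ Qo) _.
rewrite vol_affine_map// vol_scaled_ball//; last first.
  by rewrite sqrtr_gt0 divr_gt0// ltr0n.
by apply: lee_wpmul2r; rewrite ?vol_ge0// lee_fin.
Qed.

(** * Ellipsoids that attain the bound *)

(** The translation c cancels in the difference of two antipodal points of the
    ball. *)
Lemma similar_ball_diameter (R : realType) (n : nat) (r : R) (U : 'M[R]_n)
    (c : 'rV[R]_n) (S : set 'rV[R]_n) (z : 'rV[R]_n) : orthonormal_rows U ->
  @unit_ball R n `<=` affine_map (r *: U) c @` S -> unit_ball z ->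
  exists y1 y2, [/\ S y1, S y2 & 2 *: z = r *: (y1 - y2)].
Proof.
move=> Uo BS Bz.
have BzU : unit_ball (z *m U) by apply/unit_ball_isometry.
have [y1 Sy1 y1E] := BS _ BzU.
have [y2 Sy2 y2E] := BS _ (unit_ball_opp BzU).
exists y1, y2; split => //.
have [Uu _] := orthonormal_rows_sqr Uo.
apply: (can_inj (mulmxK Uu)).
rewrite -scalemxAl scaler_nat mulr2n -{2}[z *m U]opprK -y2E -y1E /affine_map.
by rewrite opprD addrACA subrr addr0 -!scalemxAr -scalerBr -mulmxBl scalemxAl.
Qed.

(** The candidate for E is the ball of radius rho in the k-plane spanned by the
    rows of Q, moved by the rotation U and the translation c.  Dividing by r
    brings it back into S; rho >= 1 lets [flat_vol_isometry] apply. *)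
Lemma ellipsoid_of_chart (R : realType) (k n : nat) (K S : set 'rV[R]_n)
    (r rho : R) (U : 'M[R]_n) (c : 'rV[R]_n) (Q : 'M[R]_(k, n)) : (0 < k)%N ->
  0 < r -> 1 <= rho -> orthonormal_rows U -> K = affine_map (r *: U) c @` S ->
  orthonormal_rows Q -> (forall x, unit_ball x -> S ((rho / r) *: (x *m Q))) ->
  exists E : set 'rV[R]_n,
    [/\ ellipsoid k E, E `<=` K &
        flat_vol k E = vol [set rho *: x | x in @unit_ball R k]].
Proof.
move=> k0 r0 rho1 Uo KE Qo QS; have rho0 : 0 < rho by exact: lt_le_trans rho1.
exists (affine_map (rho *: (Q *m U)) c @` unit_ball (n:=k)); split.
- exists (rho *: (Q *m U)), c; split => // x y.
  rewrite /affine_map => /addIr /(congr1 (mulmx^~ (Q *m U)^T)).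
  rewrite -!scalemxAr -!scalemxAl => /(scalerI (lt0r_neq0 rho0)).
  rewrite -!(mulmxA _ (Q *m U)) sqnorm_isometry// Qo !mulmx1.
  by [].
- move=> _ [x Bx <-]; rewrite KE.
  exists ((rho / r) *: (x *m Q)); first exact: QS.
  rewrite /affine_map -!scalemxAr -!scalemxAl scalerA mulmxA.
  congr (_ *: _ + _).
  by rewrite mulrC divfK// gt_eqF.
have QUo : orthonormal_rows (Q *m U).
  by rewrite /orthonormal_rows sqnorm_isometry.
rewrite -(flat_vol_isometry c k0 QUo).
  congr flat_vol; rewrite image_comp; apply: eq_imagel => x _ /=.
  by rewrite /affine_map -scalemxAr -scalemxAl.
move=> x Bx; exists (rho^-1 *: x).
  apply/unit_ballE; under eq_bigr do rewrite mxE exprMn.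
  rewrite -mulr_sumr; apply: mulr_ile1; rewrite ?sqr_ge0//.
  - by apply: sumr_ge0 => i _; exact: sqr_ge0.
  - by rewrite exprn_ile1// ?invr_ge0 ?invf_le1// ltW.
  - exact/unit_ballE.
by rewrite scalerA divff ?scale1r// gt_eqF.
Qed.

(** Coordinate j of rho x Q is the scalar product of x with rho times column j
    of Q, and both have length at most 1. *)
Lemma cube_ellipsoid (R : realType) (k m : nat) (K : set 'rV[R]_(k + m)) :
  (0 < k)%N -> cube K -> @unit_ball R (k + m) `<=` K ->
  exists E : set 'rV[R]_(k + m),
    [/\ ellipsoid k E, E `<=` K &
        flat_vol k E =
        vol [set Num.sqrt ((k + m)%:R / k%:R) *: x | x in @unit_ball R k]].
Proof.
move=> k0 [r [U [c [r0 Uo KE]]]] BK; set rho := Num.sqrt _.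
have n0 : (0 < k + m)%N by rewrite addn_gt0 k0.
have k0' : 0 < k%:R :> R by rewrite ltr0n.
have n0' : 0 < (k + m)%:R :> R by rewrite ltr0n.
have rho2 : rho ^+ 2 = (k + m)%:R / k%:R by rewrite sqr_sqrtr// divr_ge0.
have rho1 : 1 <= rho.
  rewrite -(@sqrtr1 R) ler_sqrt ?divr_gt0// ler_pdivlMr// mul1r ler_nat.
  exact: leq_addr.
have [Q [Qo Qcol]] := @equal_norm_frame R k (k + m) n0 (leq_addr _ _).
have r1 : 1 <= r.
  rewrite KE in BK; pose i := Ordinal n0.
  have [y1 [y2 [/(_ i) y1i /(_ i) y2i]]] :=
    similar_ball_diameter Uo BK (@unit_ball_delta R _ i).
  move=> /(congr1 (fun v : 'rV_(k + m) => v 0 i)); rewrite !mxE !eqxx mulr1.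
  move: y1i y2i; rewrite !ler_norml => /andP[_ y1i] /andP[y2i _].
  have : r * (y1 0 i - y2 0 i) <= r * 2 by apply: ler_wpM2l; [exact: ltW|lra].
  lra.
apply: (ellipsoid_of_chart k0 r0 rho1 Uo KE Qo) => x /unit_ballE Bx j.
rewrite mxE normrM normf_div (gtr0_norm r0) -mulrAC ler_pdivrMr// mul1r.
apply: le_trans r1; rewrite -normrM mxE mulr_sumr.
apply: le_trans (ler_norm_sum _ _ _) _.
apply: (@le_trans _ _ (\sum_(u < k) (x 0 u ^+ 2 + rho ^+ 2 * Q u j ^+ 2) / 2)).
  apply: ler_sum => u _; rewrite ler_norml.
  have := sqr_ge0 (x 0 u - rho * Q u j); have := sqr_ge0 (x 0 u + rho * Q u j).
  by move=> *; apply/andP; split; lra.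
rewrite -mulr_suml big_split /= -mulr_sumr Qcol rho2.
have -> : (k + m)%:R / k%:R * (k%:R / (k + m)%:R) = 1 :> R.
  by rewrite mulrA divfK ?divff ?gt_eqF.
lra.
Qed.

(** In R^k the 1-norm is at most sqrt k times the Euclidean norm, hence at most
    sqrt n on the ball of radius sqrt (n / k). *)
Lemma cross_polytope_ellipsoid (R : realType) (k m : nat)
    (K : set 'rV[R]_(k + m)) :
  (0 < k)%N -> regular_cross_polytope K -> @unit_ball R (k + m) `<=` K ->
  exists E : set 'rV[R]_(k + m),
    [/\ ellipsoid k E, E `<=` K &
        flat_vol k E =
        vol [set Num.sqrt ((k + m)%:R / k%:R) *: x | x in @unit_ball R k]].
Proof.
move=> k0 [r [U [c [r0 Uo KE]]]] BK; set rho := Num.sqrt _.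
have n0 : (0 < k + m)%N by rewrite addn_gt0 k0.
have k0' : 0 < k%:R :> R by rewrite ltr0n.
have n0' : 0 < (k + m)%:R :> R by rewrite ltr0n.
have rho1 : 1 <= rho.
  rewrite -(@sqrtr1 R) ler_sqrt ?divr_gt0// ler_pdivlMr// mul1r ler_nat.
  exact: leq_addr.
pose Q : 'M[R]_(k, k + m) := row_mx 1%:M 0.
have Qo : orthonormal_rows Q.
  by rewrite /orthonormal_rows tr_row_mx mul_row_col trmx1 mulmx1 mul0mx addr0.
pose w := Num.sqrt (k + m)%:R : R.
have w0 : 0 < w by rewrite sqrtr_gt0.
have w2 : w ^+ 2 = (k + m)%:R by rewrite sqr_sqrtr.
have wr : w <= r.
  rewrite KE in BK.
  (* the point of the sphere with the largest 1-norm *)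
  have Bz : unit_ball (const_mx w^-1 : 'rV[R]_(k + m)).
    apply/unit_ballE; under eq_bigr do rewrite mxE.
    by rewrite sumr_const card_ord -[leLHS]mulr_natr exprVn w2 mulVf// gt_eqF.
  have [y1 [y2 [y1S y2S /rowP yE]]] := similar_ball_diameter Uo BK Bz.
  have : \sum_(i < k + m) (2 * w^-1) <=
      r * (\sum_i `|y1 0 i| + \sum_i `|y2 0 i|).
    rewrite -big_split mulr_sumr; apply: ler_sum => i _.
    have := yE i; rewrite !mxE => ->; apply: ler_wpM2l; first exact: ltW.
    have := ler_norm (y1 0 i); have := ler_norm (- y2 0 i); rewrite normrN /=.
    lra.
  rewrite sumr_const card_ord -[leLHS]mulr_natr -w2.
  have -> : 2 * w^-1 * w ^+ 2 = 2 * w by field; rewrite gt_eqF.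
  have : r * (\sum_i `|y1 0 i| + \sum_i `|y2 0 i|) <= r * 2.
    apply: ler_wpM2l; first exact: ltW.
    by move: y1S y2S => /=; lra.
  lra.
apply: (ellipsoid_of_chart k0 r0 rho1 Uo KE Qo) => x /unit_ballE Bx /=.
under eq_bigr do rewrite mxE normrM.
rewrite -mulr_sumr ger0_norm ?divr_ge0 ?sqrtr_ge0 ?(ltW r0)//.
rewrite mulrAC ler_pdivrMr// mul1r; apply: le_trans wr.
pose q := Num.sqrt k%:R : R; have q0 : 0 < q by rewrite sqrtr_gt0.
have q2 : q ^+ 2 = k%:R by rewrite sqr_sqrtr.
have -> : w = rho * q.
  by rewrite /rho /q -sqrtrM ?divr_ge0// divfK// gt_eqF.
apply: ler_wpM2l; first exact: sqrtr_ge0.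
rewrite mul_mx_row mulmx1 mulmx0 big_split_ord /=.
under eq_bigr do rewrite row_mxEl.
rewrite [X in _ + X]big1 => [|i _]; last by rewrite row_mxEr mxE normr0.
rewrite addr0 -(ler_pM2l q0) mulr_sumr.
apply: (@le_trans _ _ (\sum_(u < k) (q ^+ 2 * x 0 u ^+ 2 + 1) / 2)).
  apply: ler_sum => u _; have := sqr_ge0 (q * `|x 0 u| - 1).
  have : `|x 0 u| ^+ 2 = x 0 u ^+ 2 by rewrite real_normK ?num_real.
  move=> <-; lra.
rewrite -mulr_suml big_split /= -mulr_sumr sumr_const card_ord -q2.
have : q ^+ 2 * \sum_(u < k) x 0 u ^+ 2 <= q ^+ 2 * 1.
  by apply: ler_wpM2l => //; exact: sqr_ge0.
rewrite -expr2; lra.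
Qed.

Theorem corollary1p3 (R : realType) (n k : nat)
    (hn : (2 <= n)%N) (hk : (1 <= k <= n.-1)%N) :
  (forall K E : set 'rV[R]_n,
     convex_body K -> centrally_symmetric K -> john_ellipsoid K (@unit_ball R n) ->
     ellipsoid k E -> E `<=` K ->
     (flat_vol k E <=
        vol [set (Num.sqrt (n%:R / k%:R) : R) *: x | x in @unit_ball R k])%E) /\
  (forall K : set 'rV[R]_n,
     regular_cross_polytope K \/ cube K -> john_ellipsoid K (@unit_ball R n) ->
     exists E : set 'rV[R]_n,
       [/\ ellipsoid k E, E `<=` K &
           flat_vol k E =
             vol [set (Num.sqrt (n%:R / k%:R) : R) *: x | x in @unit_ball R k]]).
Proof.
case/andP: hk => k0 /leq_trans/(_ (leq_pred n))/subnKC nE.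
case: _ / nE => {hn}; split; first by move=> K E; exact: flat_vol_ellipsoid_le.
move=> K [crossK|cubeK] [_ BK _].
- exact: cross_polytope_ellipsoid.
- exact: cube_ellipsoid.
Qed.
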